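(* Let $\mathcal{A}$ and $\mathcal{B}$ be the arrangements of nine planes through the origin in $\mathbb{R}^3$ given by $$\mathcal{A}:\ xyz(x+y)(x-y)(x+2y)(x+z)(y+z)(x+y+z)=0,$$ $$\mathcal{B}:\ xyz(x+y)(x+2y)(x-2y)(x+z)(2y+z)(2x+2y+z)=0.$$ Each of the two associated rank $3$ matroids has exactly $c=15$ rank $2$ flats, whose sizes sum to $s=39$. The arrangement $\mathcal{A}$ has exactly two planes containing exactly three lines of intersection, whereas $\mathcal{B}$ has exactly one such plane. Consequently, $\mathcal{A}$ and $\mathcal{B}$ have the same coarse flag polynomial, $\mathcal{N}_{\mathcal{A}}(Y,T)=\mathcal{N}_{\mathcal{B}}(Y,T)$, but their underlying matroids are not isomorphic.
   Context: The matroid of a central hyperplane arrangement $\{H_e : e\in E\}$ has ground set $E$, and its lattice of flats is the poset of all intersections $\bigcap_{e\in S}H_e$, $S\subseteq E$, ordered by reverse inclusion (an intersection corresponds to the flat of all $e$ with $H_e$ containing it). A line of intersection is a line obtained as the intersection of planes of the arrangement; these correspond to rank $2$ flats. For a matroid $M$ with lattice of flats $\mathcal{L}(M)$ (bottom $\hat 0$, top $\hat 1$, rank function $r$), the Möbius function is $\mu_M(\hat 0)=1$, $\mu_M(X)=-\sum_{X'<X}\mu_M(X')$, and the Poincaré polynomial is $\pi_M(Y)=\sum_{X\in\mathcal{L}(M)}\mu_M(X)(-Y)^{r(X)}$. For flats $X\subseteq X'$, the lattice of flats of the minor $M/X|X'$ is isomorphic to the interval $[X,X']$. Put $\overline{\mathcal{L}}(M)=\mathcal{L}(M)\setminus\{\hat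 0,\hat 1\}$, and let $\Delta(\overline{\mathcal{L}}(M))$ be the set of all flags (finite chains, including the empty one) in it. For a flag $F=(X_1<\cdots<X_\ell)$ with $X_0=\hat 0$, $X_{\ell+1}=\hat 1$, set $|F|=\ell$ and $\pi_F(Y)=\prod_{k=0}^{\ell}\pi_{M/X_k|X_{k+1}}(Y)$. The coarse flag polynomial is $$\mathcal{N}_M(Y,T)=\sum_{F\in\Delta(\overline{\mathcal{L}}(M))}\pi_F(Y)\,T^{|F|}(1-T)^{r(M)-1-|F|},$$ and for an arrangement $\mathcal{A}$ with matroid $M$ one writes $\mathcal{N}_{\mathcal{A}}=\mathcal{N}_M$. *)

(* Defs.v *)
From HB Require Import structures.
From mathcomp Require Import all_boot all_order all_algebra.
From mathcomp Require Import reals lra zify.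

Set Implicit Arguments.
Unset Strict Implicit.
Unset Printing Implicit Defensive.
Import Order.TTheory GRing.Theory Num.Theory.
Local Open Scope ring_scope.

Record matroid (E : finType) := Matroid {
  rk :> {set E} -> nat;
  rk_card : forall S, (rk S <= #|S|)%N;
  rk_mono : forall S S' : {set E}, S \subset S' -> (rk S <= rk S')%N;
  rk_submod : forall S S' : {set E},
    (rk (S :|: S') + rk (S :&: S') <= rk S + rk S')%N }.

Definition full_rk (E : finType) (M : matroid E) : nat := M [set: E].

Definition matroid_iso (E E' : finType) (M : matroid E) (M' : matroid E') :=
  exists2 f : E -> E', bijective f & forall S : {set E}, M' (f @: S) = M S.

Section Flats.
Variables (E : finType) (M : matroid E).

Definition cl (S : {set E}) : {set E} := [set e | M (e |: S) == M S].

Definition flats : {set {set E}} := [set F | cl F == F].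

(** The least flat, i.e. the set of loops; see [bot_le] and [bot_flat]. *)
Definition bot : {set E} := cl set0.

Definition rank2_flats : {set {set E}} := [set F in flats | M F == 2%N].

Lemma rk0 : M set0 = 0%N.
Proof. by apply/eqP; rewrite -leqn0 -(@cards0 E) rk_card. Qed.

Lemma in_bot e : (e \in bot) = (M [set e] == 0%N).
Proof. by rewrite inE setU0 rk0. Qed.

Lemma bot_le (F : {set E}) : F \in flats -> bot \subset F.
Proof.
rewrite inE => /eqP FE; apply/subsetP=> e; rewrite in_bot => /eqP e0.
rewrite -FE inE eqn_leq (rk_mono M (subsetU1 e F)) andbT.
by have := rk_submod M [set e] F; rewrite e0; apply: leq_trans (leq_addr _ _).
Qed.

Lemma rk_bot : M bot = 0%N.
Proof.
suff H (s : seq E) : all [in bot] s -> M [set e in s] = 0%N.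
  rewrite -(H (enum bot)); last by apply/allP=> e; rewrite mem_enum.
  by congr (M _); apply/setP=> e; rewrite inE mem_enum.
elim: s => [_|e s IHs /= /andP[]]; first by rewrite set_nil rk0.
rewrite in_bot => /eqP e0 /IHs s0; rewrite set_cons.
apply/eqP; rewrite -leqn0; have := rk_submod M [set e] [set e in s].
by rewrite e0 s0; apply: leq_trans (leq_addr _ _).
Qed.

Lemma bot_flat : bot \in flats.
Proof.
rewrite inE; apply/eqP/setP=> e; rewrite [LHS]inE rk_bot in_bot.
apply/eqP/eqP => e0; apply/eqP; rewrite -leqn0.
  by rewrite -e0 rk_mono // sub1set setU11.
have := rk_submod M [set e] bot; rewrite e0 rk_bot.
by apply: leq_trans (leq_addr _ _).
Qed.

Lemma setT_flat : [set: E] \in flats.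
Proof.
by rewrite inE; apply/eqP/setP=> e; rewrite !inE setUT eqxx.
Qed.

(** The Moebius function, by recursion on a bound on the cardinality; the
    defining recursion is [mobiusE] below. *)
Fixpoint mobius_rec (n : nat) (X : {set E}) : int :=
  if n is m.+1 then
    if X == bot then 1
    else - \sum_(X' in flats | X' \proper X) mobius_rec m X'
  else 0.

Definition mobius (X : {set E}) : int := mobius_rec #|X|.+1 X.

Lemma mobius_recE n (X : {set E}) : (#|X| < n)%N -> mobius_rec n X = mobius X.
Proof.
suff H k m (Y : {set E}) : (#|Y| < k)%N -> (#|Y| < m)%N -> mobius_rec k Y = mobius_rec m Y.
  by move=> ltXn; apply: H.
elim: k m Y => [|k IHk] [|m] Y //= ltYk ltYm; case: ifP => // _.
congr (- _); apply: eq_bigr => X' /andP[_ /proper_card ltX'].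
by apply: IHk; apply: leq_trans ltX' _.
Qed.

Lemma mobiusE (X : {set E}) : mobius X =
  if X == bot then 1 else - \sum_(X' in flats | X' \proper X) mobius X'.
Proof.
rewrite /mobius /=; case: ifP => // _; congr (- _).
by apply: eq_bigr => X' /andP[_ /proper_card ltX']; rewrite mobius_recE.
Qed.

(** [pi_M(Y)], with [Y] the variable ['X] of [{poly int}]. *)
Definition poincare : {poly int} :=
  \sum_(X in flats) mobius X *: (- 'X) ^+ M X.

End Flats.

(** The minor [M/X|X'], for [X \subset X']: ground set [X' :\: X] and rank
    function [S |-> r(S u X) - r(X)]. *)
Section Minor.
Variables (E : finType) (M : matroid E) (X X' : {set E}).

Local Notation T := {e : E | e \in X' :\: X}.

Definition minor_rk (S : {set T}) : nat := (M ((val @: S) :|: X) - M X)%N.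

Lemma minor_rk_card S : (minor_rk S <= #|S|)%N.
Proof.
rewrite leq_subLR -(card_imset S val_inj) addnC.
apply: leq_trans (leq_trans (leq_addr _ _) (rk_submod M _ _)) _.
by rewrite leq_add2r rk_card.
Qed.

Lemma minor_rk_mono (S S' : {set T}) :
  S \subset S' -> (minor_rk S <= minor_rk S')%N.
Proof. by move=> SS'; rewrite leq_sub2r // rk_mono // setSU // imsetS. Qed.

Lemma minor_rk_submod (S S' : {set T}) :
  (minor_rk (S :|: S') + minor_rk (S :&: S') <= minor_rk S + minor_rk S')%N.
Proof.
have XS (B : {set E}) : (M X <= M (B :|: X))%N by rewrite rk_mono ?subsetUr.
have := rk_submod M ((val @: S) :|: X) ((val @: S') :|: X).
rewrite -setUUl -setUIl -imsetU -imsetI; last by move=> ? ? _ _; apply: val_inj.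
rewrite /minor_rk => H.
have := XS (val @: S); have := XS (val @: S').
have := XS (val @: (S :|: S')); have := XS (val @: (S :&: S')).
move: H; move: (M _) (M _) (M _) (M _) (M _) => a b c d e.
lia.
Qed.

Definition minor : matroid T :=
  Matroid minor_rk_card minor_rk_mono minor_rk_submod.

End Minor.

Section FlagPolynomial.
Variables (E : finType) (M : matroid E).

Definition proper_flats : {set {set E}} := flats M :\ bot M :\ [set: E].

Definition flags : {set {set {set E}}} :=
  [set F : {set {set E}} | (F \subset proper_flats) &&
    [forall X in F, forall X' in F, (X \subset X') || (X' \subset X)]].

(** The chain [bot = X_0 < X_1 < ... < X_l < X_{l+1} = top]; as a flag is
    totally ordered by inclusion, sorting enumerates it increasingly. *)
Definition flag_seq (F : {set {set E}}) : seq {set E} :=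
  bot M :: rcons (sort (fun X X' : {set E} => X \subset X') (enum F)) [set: E].

Definition flag_poincare (F : {set {set E}}) : {poly int} :=
  \prod_(k < #|F|.+1)
    poincare (minor M (nth set0 (flag_seq F) k) (nth set0 (flag_seq F) k.+1)).

(** [N_M(Y,T)] as an element of [Z[Y][T]]: the outer variable is [T], the
    inner one is [Y]. For [r(M) > 0], the truncated subtraction in the
    exponent is exact, as a flag of proper flats has at most [r(M) - 1]
    members. *)
Definition coarse_flag_poly : {poly {poly int}} :=
  \sum_(F in flags)
    (flag_poincare F)%:P * 'X ^+ #|F| * (1 - 'X) ^+ (full_rk M - 1 - #|F|).

End FlagPolynomial.

Section Arrangement.
Variables (K : fieldType) (V : vectType K) (E : finType).

Record arrangement := Arrangement {
  plane :> E -> {vspace V};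
  plane_dim : forall e, (\dim (plane e)).+1 = \dim {:V};
  plane_inj : injective plane }.

Variable A : arrangement.

Definition inter (S : {set E}) : {vspace V} := (\bigcap_(e in S) A e)%VS.

(** The one-dimensional intersections of planes, without repetition. *)
Definition lines : seq {vspace V} :=
  undup [seq L <- [seq inter B | B : {set E}] | \dim L == 1%N].

Definition lines_in (e : E) : nat := count (fun L => L <= A e)%VS lines.

Definition codim (S : {set E}) : nat := (\dim {:V} - \dim (inter S))%N.

Lemma inter_sub (S S' : {set E}) :
  S \subset S' -> (inter S' <= inter S)%VS.
Proof.
move=> /subsetP SS'; apply/subv_bigcapP=> e eS.
exact: bigcapv_inf (SS' e eS) (subvv _).
Qed.

Lemma interU (S S' : {set E}) : inter (S :|: S') = (inter S :&: inter S')%VS.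
Proof.
apply/eqP; rewrite eqEsubv; apply/andP; split.
  by rewrite subv_cap !inter_sub ?subsetUl ?subsetUr.
apply/subv_bigcapP=> e; rewrite inE => /orP[] eS.
  by apply: (subv_trans (capvSl _ _)); rewrite /inter; exact: bigcapv_inf eS (subvv _).
by apply: (subv_trans (capvSr _ _)); rewrite /inter; exact: bigcapv_inf eS (subvv _).
Qed.

Lemma dim_le (U : {vspace V}) : (\dim U <= \dim {:V})%N.
Proof. by rewrite dimvS ?subvf. Qed.

Lemma codim_mono (S S' : {set E}) :
  S \subset S' -> (codim S <= codim S')%N.
Proof. by move=> SS'; rewrite leq_sub2l // dimvS // inter_sub. Qed.

Lemma codim_submod (S S' : {set E}) :
  (codim (S :|: S') + codim (S :&: S') <= codim S + codim S')%N.
Proof.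
have H : (\dim (inter S) + \dim (inter S') <=
    \dim (inter (S :|: S')) + \dim (inter (S :&: S')))%N.
  rewrite -dimv_sum_cap interU addnC leq_add2l dimvS // subv_add.
  by rewrite !inter_sub ?subsetIl ?subsetIr.
have := dim_le (inter S); have := dim_le (inter S').
have := dim_le (inter (S :|: S')); have := dim_le (inter (S :&: S')).
by rewrite /codim; move: H; do 5!move: (\dim _); lia.
Qed.

Lemma codim_card (S : {set E}) : (codim S <= #|S|)%N.
Proof.
suff H (s : seq E) : (codim [set e in s] <= size s)%N.
  rewrite cardE; apply: leq_trans (H (enum S)).
  by rewrite codim_mono //; apply/subsetP=> e; rewrite inE mem_enum.
elim: s => [|e s IHs /=]; first by rewrite set_nil /codim /inter big_set0 subnn.
rewrite set_cons; have := codim_submod [set e] [set e in s].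
move=> /(leq_trans (leq_addr _ _)) /leq_trans -> //; rewrite -add1n leq_add //.
by rewrite /codim /inter big_set1 -(plane_dim A e) subSnn.
Qed.

Definition arr_matroid : matroid E :=
  Matroid codim_card codim_mono codim_submod.

(** The flats of [arr_matroid] are the sets of all [e] such that [A e]
    contains a given intersection of planes. *)
Lemma cl_arr (S : {set E}) :
  cl arr_matroid S = [set e | (inter S <= A e)%VS].
Proof.
apply/setP=> e; rewrite !inE /= /codim.
have eS : inter (e |: S) = (A e :&: inter S)%VS.
  by rewrite interU {1}/inter big_set1.
apply/eqP/idP => [dE|/capv_idPr eSE]; last by rewrite eS eSE.
apply/capv_idPr/eqP; rewrite -eS eqEdim {1}eS capvSr /=.
by move: dE (dim_le (inter (e |: S))) (dim_le (inter S)); lia.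
Qed.

End Arrangement.

Section Forms.
Variables (K : fieldType) (V : vectType K).

Lemma dim_lker (f : 'Hom(V, K^o)) : f != 0 -> (\dim (lker f)).+1 = \dim {:V}.
Proof.
move=> f0; rewrite -(limg_ker_dim f fullv) capfv -addn1; congr addn.
apply/esym/eqP; rewrite eqn_leq; apply/andP; split.
  by apply: leq_trans (dim_le _) _; rewrite dimvf.
rewrite lt0n dimv_eq0; apply: contraNneq f0 => /eqP im0.
apply/eqP/lfunP=> v; rewrite lfunE /=; apply/eqP.
by rewrite -memv0 -(eqP im0) memv_img ?memvf.
Qed.

End Forms.

Section Planes.
Variable R : realType.
Local Notation V := 'rV[R]_3.

Definition coordinate (i : 'I_3) (v : V) : R^o := v 0 i.

Fact coordinate_linear i : linear (coordinate i).
Proof. by move=> a u v; rewrite /coordinate !mxE. Qed.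

HB.instance Definition _ i :=
  GRing.isLinear.Build R V R^o _ (coordinate i) (coordinate_linear i).

Let x : 'Hom(V, R^o) := linfun (coordinate 0).
Let y : 'Hom(V, R^o) := linfun (coordinate 1).
Let z : 'Hom(V, R^o) := linfun (coordinate 2%:R).

(** The linear factors, as elements of the dual space. *)
Definition formsA : 9.-tuple 'Hom(V, R^o) :=
  [tuple x; y; z; x + y; x - y; x + 2 *: y; x + z; y + z; x + y + z].

Definition formsB : 9.-tuple 'Hom(V, R^o) :=
  [tuple x; y; z; x + y; x + 2 *: y; x - 2 *: y; x + z; 2 *: y + z;
         2 *: x + 2 *: y + z].

Definition vec (a b c : R) : V := \row_j [:: a; b; c]`_j.

Lemma linfun_coordinate i a b c :
  linfun (coordinate i) (vec a b c) = [:: a; b; c]`_i.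
Proof. by rewrite lfunE /= /coordinate mxE. Qed.

Let vecE :=
  (add_lfunE, opp_lfunE, scale_lfunE, linfun_coordinate).

Lemma formsA_vec e a b c : tnth formsA e (vec a b c) =
  [:: a; b; c; a + b; a - b; a + 2 * b; a + c; b + c; a + b + c]`_e.
Proof.
by case: e => -[|[|[|[|[|[|[|[|[|//]]]]]]]]] lt9;
  rewrite (tnth_nth 0) /= !vecE.
Qed.

Lemma formsB_vec e a b c : tnth formsB e (vec a b c) =
  [:: a; b; c; a + b; a + 2 * b; a - 2 * b; a + c; 2 * b + c;
      2 * a + 2 * b + c]`_e.
Proof.
by case: e => -[|[|[|[|[|[|[|[|[|//]]]]]]]]] lt9;
  rewrite (tnth_nth 0) /= !vecE.
Qed.

Lemma lker_eq_forms (f g : 'Hom(V, R^o)) (u v : V) :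
  lker f = lker g -> f u * g v = f v * g u.
Proof.
move=> fg; have E (h : 'Hom(V, R^o)) :
    h ((f u : R) *: v - (f v : R) *: u) = f u * h v - f v * h u.
  by rewrite linearB /= !linearZ.
have : (f u : R) *: v - (f v : R) *: u \in lker f.
  by rewrite memv_ker E mulrC subrr.
by rewrite fg memv_ker E subr_eq0 => /eqP.
Qed.

(** The planes are the kernels of the linear factors of the defining
    polynomial, indexed by the position of the factor. *)
Definition planes_of (f : 9.-tuple 'Hom(V, R^o)) (e : 'I_9) : {vspace V} :=
  lker (tnth f e).

Lemma formsA_dim e : (\dim (planes_of formsA e)).+1 = \dim {:V}.
Proof.
apply/dim_lker/eqP => /lfunP f0.
move: (f0 (vec 1 0 0)) (f0 (vec 0 1 0)) (f0 (vec 0 0 1)).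
rewrite !formsA_vec !zero_lfunE.
by case: e {f0} => -[|[|[|[|[|[|[|[|[|//]]]]]]]]] lt9 /=; lra.
Qed.

Lemma formsB_dim e : (\dim (planes_of formsB e)).+1 = \dim {:V}.
Proof.
apply/dim_lker/eqP => /lfunP f0.
move: (f0 (vec 1 0 0)) (f0 (vec 0 1 0)) (f0 (vec 0 0 1)).
rewrite !formsB_vec !zero_lfunE.
by case: e {f0} => -[|[|[|[|[|[|[|[|[|//]]]]]]]]] lt9 /=; lra.
Qed.

Lemma formsA_inj : injective (planes_of formsA).
Proof.
move=> i j ij; apply/val_inj/eqP; move: ij; apply: contra_eqT => ij.
apply/negP => /eqP fg.
move: (lker_eq_forms (vec 1 0 0) (vec 0 1 0) fg)
      (lker_eq_forms (vec 1 0 0) (vec 0 0 1) fg)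
      (lker_eq_forms (vec 0 1 0) (vec 0 0 1) fg).
rewrite !formsA_vec; move: ij {fg}.
by case: i => -[|[|[|[|[|[|[|[|[|//]]]]]]]]] lti;
  case: j => -[|[|[|[|[|[|[|[|[|//]]]]]]]]] ltj //= _; lra.
Qed.

Lemma formsB_inj : injective (planes_of formsB).
Proof.
move=> i j ij; apply/val_inj/eqP; move: ij; apply: contra_eqT => ij.
apply/negP => /eqP fg.
move: (lker_eq_forms (vec 1 0 0) (vec 0 1 0) fg)
      (lker_eq_forms (vec 1 0 0) (vec 0 0 1) fg)
      (lker_eq_forms (vec 0 1 0) (vec 0 0 1) fg).
rewrite !formsB_vec; move: ij {fg}.
by case: i => -[|[|[|[|[|[|[|[|[|//]]]]]]]]] lti;
  case: j => -[|[|[|[|[|[|[|[|[|//]]]]]]]]] ltj //= _; lra.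
Qed.

Definition arrA : arrangement V 'I_9 := Arrangement formsA_dim formsA_inj.

Definition arrB : arrangement V 'I_9 := Arrangement formsB_dim formsB_inj.

End Planes.

(* Main.v *)
Require Import Defs.
From mathcomp Require Import all_boot all_order all_algebra.
From mathcomp Require Import reals ring zify.

Set Implicit Arguments.
Unset Strict Implicit.
Unset Printing Implicit Defensive.
Import GRing.Theory.
Local Open Scope ring_scope.

(** The coarse flag polynomial of a matroid of rank 3 depends only on three
    numbers: the number [a] of rank 1 flats (points), the number [c] of rank 2
    flats (lines), and the number [i] of incident pairs of a point and a line.
    Every factor of a flag polynomial is the Poincare polynomial of an interval
    of the lattice of flats.  An interval of length 1 gives [1 + Y]; one of
    length 2 with [d] atoms gives [1 + d Y + (d - 1) Y^2]; the whole lattice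
    gives [1 + a Y + (i - c) Y^2 + (1 - a + i - c) Y^3], because the Moebius
    function is [-1] at a point and [d - 1] at a line with [d] points
    ([poincare_rk3]).  The polynomials of length 2 are affine in [d], so that
    summing them over all lines, or over all points, leaves only [c], [a] and
    [i] ([coarse_flag_poly_rk3]).  In a simple matroid the points are the
    elements of the ground set and [i] is the sum [s] of the sizes of the lines
    ([simple_coarse_flag_poly]), so two simple matroids of rank 3 with the same
    number of elements and the same [c] and [s] have the same coarse flag
    polynomial.

    On the other hand, an isomorphism preserves the number of elements that lie
    on exactly [k] rank 2 flats ([iso_lines_at]).  For planes in space these
    flats correspond to the lines of intersection ([lines_inE]), and [k = 3]
    distinguishes the two arrangements.

    The planes have integer normal vectors.  Two distinct planes meet in the
    line spanned by the cross product of their normals, hence the rank 2 flat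
    spanned by [i] and [j] consists of the [k] with
    [det (n_i, n_j, n_k) = 0] ([coplanarP]).  The list of all rank 2 flats is
    thus computable, and every count is read off from it. *)

(** * Closure and flats *)

Section Closure.
Variables (E : finType) (M : matroid E).
Implicit Types S F : {set E}.

Lemma sub_cl S : S \subset cl M S.
Proof.
by apply/subsetP=> e eS; rewrite inE (setUidPr _) // sub1set.
Qed.

Lemma cl_mono S S' : S \subset S' -> cl M S \subset cl M S'.
Proof.
move=> SS'; apply/subsetP=> e; rewrite !inE => /eqP eS.
rewrite eqn_leq (rk_mono M (subsetU1 e S')) andbT.
have := rk_submod M (e |: S) S'.
have -> : (e |: S) :|: S' = e |: S' by rewrite -setUA (setUidPr SS').
have : (M S <= M ((e |: S) :&: S'))%N by rewrite rk_mono // subsetI subsetU1.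
by rewrite eS; lia.
Qed.

(** Adding the elements of the closure one at a time never raises the rank: an
    element of [cl S] remains in the closure of every larger set. *)
Lemma rk_cl S : M (cl M S) = M S.
Proof.
suff H (s : seq E) : all [in cl M S] s -> M (S :|: [set e in s]) = M S.
  rewrite -[RHS](H (enum (cl M S))); last by apply/allP=> e; rewrite mem_enum.
  by rewrite set_enum (setUidPr (sub_cl S)).
elim: s => [_|e s IHs /= /andP[eS /IHs sS]]; first by rewrite set_nil setU0.
have : e \in cl M (S :|: [set e in s]) by apply: subsetP eS; rewrite cl_mono ?subsetUl.
by rewrite inE set_cons setUCA => /eqP->.
Qed.

Lemma cl_flat S : cl M S \in flats M.
Proof.
rewrite inE eqEsubset sub_cl andbT; apply/subsetP=> e; rewrite !inE => /eqP eS.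
rewrite eqn_leq (rk_mono M (subsetU1 e S)) andbT -[leqRHS]rk_cl -eS.
by rewrite rk_mono // setUS ?sub_cl.
Qed.

Lemma cl_sub_flat S F : F \in flats M -> S \subset F -> cl M S \subset F.
Proof. by rewrite inE => /eqP {2}<-; apply: cl_mono. Qed.

Lemma flatP F : reflect (forall e, e \notin F -> (M F < M (e |: F))%N) (F \in flats M).
Proof.
rewrite inE eqEsubset sub_cl andbT; apply: (iffP subsetP) => H e.
  move=> eF; rewrite ltn_neqAle (rk_mono M (subsetU1 e F)) andbT eq_sym.
  by apply: contra eF => eF; apply: H; rewrite inE.
by rewrite inE => eE; apply: contraLR eE => /H; rewrite ltn_neqAle eq_sym => /andP[].
Qed.

Lemma flat_eq_cl S F :
  F \in flats M -> S \subset F -> (M F <= M S)%N -> F = cl M S.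
Proof.
move=> fF SF FS; apply/eqP; rewrite eqEsubset cl_sub_flat // andbT.
apply/subsetP=> e eF; rewrite inE eqn_leq (rk_mono M (subsetU1 e S)) andbT.
by apply: leq_trans FS; rewrite rk_mono // subUset sub1set eF.
Qed.

Lemma flat_rk_eq F F' : F \in flats M -> F' \in flats M ->
  F \subset F' -> (M F' <= M F)%N -> F = F'.
Proof.
move=> fF fF' FF' leF; rewrite (flat_eq_cl fF' FF' leF).
by move: fF; rewrite inE => /eqP.
Qed.

Lemma flat_proper F F' : F \in flats M -> F' \in flats M ->
  (F \proper F') = (F \subset F') && (M F < M F')%N.
Proof.
move=> fF fF'; rewrite properEneq andbC.
case FF': (F \subset F') => //=; have [FE|ltF] := leqP (M F') (M F).
  by rewrite (flat_rk_eq fF fF' FF' FE) eqxx.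
by apply: contraTN ltF => /eqP->; rewrite ltnn.
Qed.

(** * Moebius function and Poincare polynomial in rank at most 3 *)

Definition flats_rk k : {set {set E}} := [set F in flats M | M F == k].

Lemma flats_rkP k F : reflect (F \in flats M /\ M F = k) (F \in flats_rk k).
Proof. by apply: (iffP setIdP) => -[fF /eqP]. Qed.

Lemma flats_rk0 : flats_rk 0 = [set bot M].
Proof.
apply/setP=> F; rewrite in_set1; apply/flats_rkP/eqP => [[fF F0]|->].
  by apply/esym/flat_rk_eq; rewrite ?bot_flat ?bot_le ?F0.
by rewrite bot_flat rk_bot.
Qed.

Lemma flats_rk_full : flats_rk (full_rk M) = [set [set: E]].
Proof.
apply/setP=> F; rewrite in_set1; apply/flats_rkP/eqP => [[fF F0]|->].
  by apply: flat_rk_eq; rewrite ?setT_flat ?subsetT ?F0.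
by rewrite setT_flat.
Qed.

Lemma rk_le_full S : (M S <= full_rk M)%N.
Proof. by rewrite rk_mono // subsetT. Qed.

Lemma sum_flats_by_rk (V : nmodType) n (P : pred {set E}) (G : {set E} -> V) :
  (forall F, F \in flats M -> P F -> (M F < n)%N) ->
  \sum_(F in flats M | P F) G F =
  \sum_(k < n) \sum_(F in flats_rk k | P F) G F.
Proof.
move=> ltn; case: n ltn => [|n] ltn.
  by rewrite big_ord0 big_pred0 // => F; apply/andP=> -[/ltn H /H].
rewrite (partition_big (fun F => inord (M F) : 'I_n.+1) xpredT) //=.
apply: eq_bigr => k _; apply: eq_bigl => F.
have -> : (F \in flats_rk k) = (F \in flats M) && (M F == k).
  by apply/flats_rkP/andP => -[fF /eqP].
rewrite [RHS]andbAC; case fF: (F \in flats M) => //=; case PF: (P F) => //=.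
by rewrite -val_eqE /= inordK // ltn.
Qed.

(** The recursion for the Moebius function with the smaller flats grouped by
    rank; in small rank each group has a closed formula. *)
Lemma mobius_by_rk F : F \in flats M -> (0 < M F)%N ->
  mobius M F = - \sum_(k < M F) \sum_(X in flats_rk k | X \subset F) mobius M X.
Proof.
move=> fF F0; rewrite mobiusE ifN; last first.
  by apply: contraTneq F0 => ->; rewrite rk_bot.
congr (- _); rewrite (@sum_flats_by_rk _ (M F)); last first.
  by move=> X fX; rewrite flat_proper // => /andP[].
apply: eq_bigr => k _; apply: eq_bigl => X.
case: flats_rkP => //= -[fX rX]; rewrite flat_proper // rX.
by rewrite ltn_ord andbT.
Qed.

Lemma mobius_bot : mobius M (bot M) = 1.
Proof. by rewrite mobiusE eqxx. Qed.

Lemma sum_bot (V : nmodType) (P : pred {set E}) (G : {set E} -> V) :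
  P (bot M) -> \sum_(X in flats_rk 0 | P X) G X = G (bot M).
Proof. by move=> PX; rewrite flats_rk0 big_mkcondr big_set1 PX. Qed.

Lemma mobius_rk1 P : P \in flats_rk 1 -> mobius M P = -1.
Proof.
case/flats_rkP=> fP P1; rewrite mobius_by_rk ?P1 // big_ord1 sum_bot ?bot_le //.
by rewrite mobius_bot.
Qed.

Definition points_on (L : {set E}) : {set {set E}} :=
  [set P in flats_rk 1 | P \subset L].

Definition lines_through (P : {set E}) : {set {set E}} :=
  [set L in flats_rk 2 | P \subset L].

Lemma sum_mobius_points_on (L : {set E}) :
  \sum_(P in flats_rk 1 | P \subset L) mobius M P = - (#|points_on L|%:R).
Proof.
rewrite -sumr_const (eq_bigl [in points_on L]); last by move=> P; rewrite !inE.
by rewrite -sumrN; apply: eq_bigr => P /setIdP[/mobius_rk1].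
Qed.

Lemma mobius_rk2 L : L \in flats_rk 2 -> mobius M L = #|points_on L|%:R - 1.
Proof.
case/flats_rkP=> fL L2; rewrite mobius_by_rk ?L2 // big_ord_recr big_ord1 /=.
by rewrite sum_bot ?bot_le // mobius_bot sum_mobius_points_on opprB.
Qed.

Lemma poincare_by_rk : poincare M =
  \sum_(k < (full_rk M).+1) (\sum_(F in flats_rk k) mobius M F) *: (- 'X) ^+ k.
Proof.
transitivity (\sum_(F in flats M | xpredT F) mobius M F *: (- 'X) ^+ M F).
  by apply: eq_bigl => F; rewrite andbT.
rewrite (@sum_flats_by_rk _ (full_rk M).+1) => [|F _ _]; last first.
  by rewrite ltnS rk_le_full.
apply: eq_bigr => k _; rewrite scaler_suml; apply: eq_big => F.
  by rewrite andbT.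
by rewrite andbT => /flats_rkP[_ ->].
Qed.

Lemma mobius_top : (0 < full_rk M)%N ->
  mobius M [set: E] = - \sum_(k < full_rk M) \sum_(F in flats_rk k) mobius M F.
Proof.
move=> r0; rewrite mobius_by_rk ?setT_flat //; congr (- _).
by apply: eq_bigr => k _; apply: eq_bigl => F; rewrite subsetT andbT.
Qed.

Definition incidences : nat := \sum_(L in flats_rk 2) #|points_on L|.

(** Double counting: incident pairs may be grouped by the line or by the point. *)
Lemma incidences_sym : incidences = (\sum_(P in flats_rk 1) #|lines_through P|)%N.
Proof.
rewrite /incidences.
under eq_bigr do rewrite -sum1_card; under [RHS]eq_bigr do rewrite -sum1_card.
rewrite (exchange_big_dep [in flats_rk 1]) /=; last first.
  by move=> L P _; rewrite inE => /andP[].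
apply: eq_bigr => P PP; apply: eq_bigl => L.
by apply/andP/setIdP => -[LL]; [case/setIdP | move=> PL; split=> //; apply/setIdP].
Qed.

Let sum0 : \sum_(F in flats_rk 0) mobius M F = 1.
Proof. by rewrite flats_rk0 big_set1 mobius_bot. Qed.

Let sum1 : \sum_(F in flats_rk 1) mobius M F = - (#|flats_rk 1|%:R).
Proof. by rewrite -sumr_const -sumrN; apply: eq_bigr => P /mobius_rk1. Qed.

Let sum2 : \sum_(F in flats_rk 2) mobius M F = incidences%:R - #|flats_rk 2|%:R.
Proof.
rewrite -sumr_const natr_sum -sumrB.
by apply: eq_bigr => P /mobius_rk2.
Qed.

Let sum_top : (0 < full_rk M)%N ->
  \sum_(F in flats_rk (full_rk M)) mobius M F =
  - \sum_(k < full_rk M) \sum_(F in flats_rk k) mobius M F.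
Proof. by move=> r0; rewrite flats_rk_full big_set1 mobius_top. Qed.

(** The Poincare polynomials in ranks 1, 2 and 3, for [a] points, [c] lines and
    [i] incidences.  The powers of [- 'X] cancel the alternating signs of the
    Moebius function. *)
Definition pi1 : {poly int} := 1 + 'X.

Definition pi2 (a : nat) : {poly int} := 1 + 'X *+ a + 'X ^+ 2 *+ a - 'X ^+ 2.

Definition pi3 (a c i : nat) : {poly int} :=
  1 + 'X *+ a + 'X ^+ 2 *+ i - 'X ^+ 2 *+ c + 'X ^+ 3 - 'X ^+ 3 *+ a
  + 'X ^+ 3 *+ i - 'X ^+ 3 *+ c.

Lemma poincare_rk1 : full_rk M = 1%N -> poincare M = pi1.
Proof.
move=> r1; rewrite poincare_by_rk; have := sum_top; rewrite r1 => top.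
rewrite big_ord_recr big_ord1 /= top // big_ord1 sum0 /pi1 -!mul_polyC.
by rewrite !rmorphE /=; ring.
Qed.

Lemma poincare_rk2 : full_rk M = 2%N -> poincare M = pi2 #|flats_rk 1|.
Proof.
move=> r2; rewrite poincare_by_rk; have := sum_top; rewrite r2 => top.
rewrite !big_ord_recr big_ord0 /= top // !big_ord_recr big_ord0 /= sum0 sum1.
by rewrite /pi2 -!mul_polyC !rmorphE /=; ring.
Qed.

Lemma poincare_rk3 : full_rk M = 3%N ->
  poincare M = pi3 #|flats_rk 1| #|flats_rk 2| incidences.
Proof.
move=> r3; rewrite poincare_by_rk; have := sum_top; rewrite r3 => top.
rewrite !big_ord_recr big_ord0 /= top // !big_ord_recr big_ord0 /= sum0 sum1 sum2.
by rewrite /pi3 -!mul_polyC !rmorphE /=; ring.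
Qed.

End Closure.

(** * Flats of a minor *)

Section MinorFlats.
Variables (E : finType) (M : matroid E) (X X' : {set E}).
Hypotheses (fX' : X' \in flats M) (XX' : X \subset X').

Local Notation N := (minor M X X').
Local Notation T := {e : E | e \in X' :\: X}.

(** The isomorphism from the lattice of flats of [M/X|X'] onto the interval
    [[X, X']]; it shifts the rank by [M X]. *)
Definition lift_flat (S : {set T}) : {set E} := val @: S :|: X.

Lemma lift_flat_sub S : (X \subset lift_flat S) && (lift_flat S \subset X').
Proof.
rewrite subsetUr subUset XX' andbT; apply/subsetP=> _ /imsetP[e _ ->].
by case/setDP: (valP e).
Qed.

Lemma mem_lift_flat S (e : T) : (val e \in lift_flat S) = (e \in S).
Proof.
rewrite inE mem_imset; last exact: val_inj.
by have /setDP[_ /negbTE->] := valP e; rewrite orbF.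
Qed.

Lemma lift_flat_subset S S' : (lift_flat S \subset lift_flat S') = (S \subset S').
Proof.
apply/idP/idP => [/subsetP H|SS']; last by rewrite setSU ?imsetS.
by apply/subsetP=> e; rewrite -!mem_lift_flat; apply: H.
Qed.

Lemma lift_flat_onto (Z : {set E}) : X \subset Z -> Z \subset X' ->
  lift_flat (val @^-1: Z) = Z.
Proof.
move=> /subsetP XZ /subsetP ZX'; apply/setP=> e; apply/setUP/idP => [[]|eZ].
- by case/imsetP=> t; rewrite inE => tZ ->.
- exact: XZ.
- case eX: (e \in X); [by right | left].
  have eT : e \in X' :\: X by rewrite inE eX ZX'.
  by apply/imsetP; exists (exist _ e eT); rewrite ?inE.
Qed.

Lemma rk_lift_flat S : M (lift_flat S) = (N S + M X)%N.
Proof. by rewrite subnK // rk_mono // subsetUr. Qed.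

Lemma full_rk_minor : full_rk N = (M X' - M X)%N.
Proof.
have liftT : lift_flat [set: T] = X'.
  rewrite -[RHS](lift_flat_onto XX' (subxx _)); congr lift_flat.
  by apply/setP=> e; rewrite !inE; case/setDP: (valP e) => ->.
by have := rk_lift_flat [set: T]; rewrite liftT => ->; rewrite addnK.
Qed.

(** An element outside the flat [X'] raises the rank of every subset of [X'], so
    the elements of the minor decide whether such a subset is closed. *)
Lemma lift_flat_flat S : (lift_flat S \in flats M) = (S \in flats N).
Proof.
have liftU e : lift_flat (e |: S) = val e |: lift_flat S.
  by rewrite /lift_flat imsetU1 setUA.
apply/flatP/flatP => H e eS.
  by rewrite -(ltn_add2r (M X)) -!rk_lift_flat liftU H // mem_lift_flat.
case eX': (e \in X'); last first.
  have /andP[_ SX'] := lift_flat_sub S.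
  have : e \notin cl M (lift_flat S).
    apply: contraFN eX' => /(subsetP (cl_sub_flat fX' SX')); exact.
  by rewrite inE ltn_neqAle eq_sym => ->; rewrite rk_mono ?subsetU1.
have eT : e \in X' :\: X.
  by rewrite inE eX' andbT; apply: contra eS => eX; rewrite inE eX orbT.
have := H (exist _ e eT); rewrite -mem_lift_flat => /(_ eS).
by rewrite -(ltn_add2r (M X)) -!rk_lift_flat liftU.
Qed.

Lemma sum_minor_flats (V : nmodType) k (P : pred {set E}) (G : {set E} -> V) :
  \sum_(S in flats_rk N k | P (lift_flat S)) G (lift_flat S) =
  \sum_(Z in flats_rk M (k + M X)%N | [&& X \subset Z, Z \subset X' & P Z]) G Z.
Proof.
have HE S : S \in flats_rk N k = (lift_flat S \in flats_rk M (k + M X)%N).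
  apply/flats_rkP/flats_rkP; rewrite lift_flat_flat rk_lift_flat => -[fS].
    by move=> ->.
  by move/addIn.
rewrite [RHS](reindex_onto lift_flat (fun Z => val @^-1: Z)) /=; last first.
  by move=> Z /and3P[_ XZ /andP[ZX' _]]; apply: lift_flat_onto.
apply: eq_bigl => S; rewrite HE; have /andP[-> ->] := lift_flat_sub S.
have -> : val @^-1: lift_flat S = S.
  by apply/setP=> e; rewrite inE mem_lift_flat.
by rewrite eqxx andbT.
Qed.

Lemma card_minor_flats k : #|flats_rk N k| =
  #|[set Z in flats_rk M (k + M X)%N | (X \subset Z) && (Z \subset X')]|.
Proof.
have := sum_minor_flats k xpredT (fun=> 1%N).
rewrite -!sum1_card => H; transitivity (\sum_(S in flats_rk N k | true) 1)%N.
  by apply: eq_bigl => S; rewrite andbT.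
rewrite H; apply: eq_bigl => Z; rewrite !inE andbT //.
Qed.

End MinorFlats.

(** * Flags in a matroid of rank 3 *)

Lemma sum_setU (V : nmodType) (T : finType) (A B : {set T}) (G : T -> V) :
  (forall x, x \in A -> x \notin B) ->
  \sum_(x in A :|: B) G x = \sum_(x in A) G x + \sum_(x in B) G x.
Proof.
move=> AB; rewrite -bigU /=; first by apply: eq_bigl => x; rewrite !inE.
by rewrite disjoint_subset; apply/subsetP=> x /AB.
Qed.

Section Flags.
Variables (E : finType) (M : matroid E).

(** The interval from the bottom to the top is the whole lattice, but this minor
    lives on the subtype of non-loops, so its point, line and incidence counts
    have to be carried back to [M]. *)
Lemma poincare_minor_full : full_rk M = 3%N ->
  poincare (minor M (bot M) [set: E]) =
  pi3 #|flats_rk M 1| #|flats_rk M 2| (incidences M).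
Proof.
move=> r3; have fb := bot_flat M; have fT := setT_flat M.
have sT : bot M \subset [set: E] by rewrite subsetT.
rewrite poincare_rk3 ?full_rk_minor // ?rk_bot ?subn0 //.
have HE k : [set Z in flats_rk M (k + M (bot M))%N |
    (bot M \subset Z) && (Z \subset [set: E])] = flats_rk M k.
  rewrite rk_bot addn0; apply/setP=> Z; apply/setIdP/idP => [[]|ZZ] //.
  by case/flats_rkP: (ZZ) => /bot_le-> _; rewrite subsetT.
rewrite !card_minor_flats // !HE; congr pi3.
rewrite /incidences.
transitivity (\sum_(L in flats_rk (minor M (bot M) [set: E]) 2 | xpredT L)
  #|points_on M (lift_flat L)|)%N.
  apply: eq_big => [L|L _]; first by rewrite andbT.
  rewrite -!sum1_card.
  transitivity (\sum_(P in flats_rk (minor M (bot M) [set: E]) 1 |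
     lift_flat P \subset lift_flat L) 1)%N.
    by apply: eq_bigl => P; rewrite lift_flat_subset; apply/setIdP/andP.
  rewrite (@sum_minor_flats _ M _ _ fT sT _ 1
    (fun Z => Z \subset lift_flat L) (fun=> 1%N)).
  apply: eq_bigl => P; rewrite rk_bot subsetT /= andbA andbAC -andbA.
  apply/andP/setIdP => -[] => [-> /andP[]//|PP ->].
  by rewrite PP; case/flats_rkP: PP => /bot_le->.
rewrite (@sum_minor_flats _ M _ _ fT sT _ 2 xpredT (fun L => #|points_on M L|)).
by apply: eq_bigl => L; rewrite andbT -[in RHS]HE inE.
Qed.

Lemma poincare_minor_rk1 (X X' : {set E}) : X' \in flats M -> X \subset X' ->
  (M X' = (M X).+1)%N -> poincare (minor M X X') = pi1.
Proof.
by move=> fX' XX' r1; rewrite poincare_rk1 // full_rk_minor // r1 subSnn.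
Qed.

Lemma poincare_minor_point P : full_rk M = 3%N -> P \in flats_rk M 1 ->
  poincare (minor M P [set: E]) = pi2 #|lines_through M P|.
Proof.
move=> r3 /flats_rkP[fP P1].
rewrite poincare_rk2 ?full_rk_minor ?subsetT ?setT_flat ?P1 //; last first.
  by rewrite -/(full_rk M) r3.
rewrite card_minor_flats ?setT_flat ?subsetT // P1; congr pi2.
by apply: eq_card => L; apply/setIdP/setIdP; rewrite subsetT andbT.
Qed.

Lemma poincare_minor_line L : L \in flats_rk M 2 ->
  poincare (minor M (bot M) L) = pi2 #|points_on M L|.
Proof.
case/flats_rkP=> fL L2.
rewrite poincare_rk2 ?full_rk_minor ?bot_le ?L2 ?rk_bot //.
rewrite card_minor_flats ?bot_le // rk_bot addn0; congr pi2.
apply: eq_card => P; apply/setIdP/setIdP => -[PP]; first by case/andP.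
by move->; rewrite bot_le //; case/flats_rkP: PP.
Qed.

Hypothesis r3 : full_rk M = 3%N.

Lemma proper_flatsE : proper_flats M = flats_rk M 1 :|: flats_rk M 2.
Proof.
apply/setP=> F; apply/setD1P/setUP => [[FT /setD1P[Fb fF]]|FF].
  have := rk_le_full M F; rewrite r3.
  case rF: (M F) => [|[|[|[|//]]]] _.
  - have : F \in flats_rk M 0 by apply/flats_rkP.
    by rewrite flats_rk0 inE (negbTE Fb).
  - by left; apply/flats_rkP.
  - by right; apply/flats_rkP.
  - have : F \in flats_rk M (full_rk M) by rewrite r3; apply/flats_rkP.
    by rewrite flats_rk_full inE (negbTE FT).
have [fF rF] : F \in flats M /\ (M F == 1%N) || (M F == 2%N).
  by case: FF => /flats_rkP[? ->].
split; first by apply: contraTneq rF => ->; rewrite -/(full_rk M) r3.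
by apply/setD1P; split=> //; apply: contraTneq rF => ->; rewrite rk_bot.
Qed.

Definition incident_pairs : {set {set E} * {set E}} :=
  [set p | [&& p.1 \in flats_rk M 1, p.2 \in flats_rk M 2 & p.1 \subset p.2]].

Lemma in_incident_pairs P L : ((P, L) \in incident_pairs) =
  [&& P \in flats_rk M 1, L \in flats_rk M 2 & P \subset L].
Proof. by rewrite in_set. Qed.

(** Comparable flats of equal rank coincide, so a flag has at most one point and
    at most one line. *)
Lemma flagsE : flags M = [set set0] :|: [set [set X] | X in proper_flats M]
  :|: [set [set p.1; p.2] | p in incident_pairs].
Proof.
apply/setP=> F; apply/setIdP/setUP => [[/subsetP Fp /forall_inP chF]|].
  have [->|/set0Pn[X XF]] := eqVneq F set0; first by left; rewrite !inE eqxx.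
  have [->|FX] := eqVneq F [set X].
    by left; apply/setUP; right; apply/imsetP; exists X; rewrite ?Fp.
  right; have /subsetPn[Y YF YX] : ~~ (F \subset [set X]).
    by apply: contra FX => FX; rewrite eqEsubset FX sub1set.
  have rkF Z : Z \in F -> Z \in flats M /\ (M Z == 1%N) || (M Z == 2%N).
    by move/Fp; rewrite proper_flatsE => /setUP[] /flats_rkP[? ->].
  have eqF Z Z' : Z \in F -> Z' \in F -> M Z = M Z' -> Z = Z'.
    move=> ZF Z'F rZ; have [fZ _] := rkF _ ZF; have [fZ' _] := rkF _ Z'F.
    case/orP: (forall_inP (chF _ ZF) _ Z'F) => ZZ'.
      by apply: (flat_rk_eq fZ fZ'); rewrite ?rZ.
    by apply/esym/(flat_rk_eq fZ' fZ); rewrite ?rZ.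
  have {X Y FX XF YX YF} [P [L [PF LF P1 L2]]] : exists P L,
      [/\ P \in F, L \in F, M P = 1%N & M L = 2%N].
    have rXY : M X != M Y by apply: contra YX => /eqP/eqF ->; rewrite ?set11.
    have [_ /orP[]/eqP rX] := rkF _ XF; have [_ /orP[]/eqP rY] := rkF _ YF;
      move: rXY; rewrite rX rY // => _; by [exists X, Y | exists Y, X].
  have [fP _] := rkF _ PF; have [fL _] := rkF _ LF.
  have PL : P \subset L.
    case/orP: (forall_inP (chF _ PF) _ LF) => // /(rk_mono M).
    by rewrite P1 L2.
  apply/imsetP; exists (P, L) => /=.
    by rewrite in_incident_pairs PL andbT; apply/andP; split; apply/flats_rkP.
  apply/setP=> Z; rewrite !inE; apply/idP/orP => [ZF|[]/eqP-> //].
  by have [_ /orP[]/eqP rZ] := rkF _ ZF; [left | right];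
    apply/eqP/eqF; rewrite ?rZ.
case=> [/setUP[/set1P->|/imsetP[X XX ->]]|/imsetP[[P L] pPL ->]].
- by rewrite sub0set; split=> //; apply/forall_inP => X; rewrite inE.
- rewrite sub1set; split=> //; apply/forall_inP => Y /set1P->.
  by apply/forall_inP => Z /set1P->; rewrite subxx.
move: pPL; rewrite in_incident_pairs => /and3P[PP LL PL].
rewrite subUset !sub1set proper_flatsE !in_setU PP LL orbT; split=> //.
apply/forall_inP => X; rewrite !inE => /orP[]/eqP->;
  by apply/forall_inP => Y; rewrite !inE => /orP[]/eqP->; rewrite ?subxx ?PL ?orbT.
Qed.

Lemma sum_flags (V : nmodType) (G : {set {set E}} -> V) :
  \sum_(F in flags M) G F = G set0
    + (\sum_(P in flats_rk M 1) G [set P] + \sum_(L in flats_rk M 2) G [set L])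
    + \sum_(L in flats_rk M 2) \sum_(P in points_on M L) G [set P; L].
Proof.
have PneL p : p \in incident_pairs -> p.1 != p.2.
  rewrite inE => /and3P[/flats_rkP[_ rP] /flats_rkP[_ rL] _].
  by apply: contraTneq isT => pE; move: rP; rewrite pE rL.
rewrite flagsE sum_setU /=; last first.
  move=> F /setUP H; apply/negP=> /imsetP[p /PneL pp FE].
  have : #|F| = 2%N by rewrite FE cards2 pp.
  by case: H => [/set1P->|/imsetP[X _ ->]]; rewrite ?cards0 ?cards1.
rewrite sum_setU /=; last first.
  move=> F /set1P->; apply/negP=> /imsetP[X _ /setP/(_ X)].
  by rewrite !inE eqxx.
rewrite big_set1 big_imset /=; last by move=> X Y _ _; apply: set1_inj.
rewrite proper_flatsE sum_setU /=; last first.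
  move=> F /flats_rkP[_ r1]; apply/negP=> /flats_rkP[_].
  by rewrite r1.
congr (_ + _); rewrite big_imset /=; last first.
  move=> [P L] [P' L']; rewrite !in_incident_pairs .
  move=> /and3P[/flats_rkP[_ rP] /flats_rkP[_ rL] _].
  move=> /and3P[/flats_rkP[_ rP'] /flats_rkP[_ rL'] _] /setP H.
  have := H P; rewrite !inE eqxx => /esym/orP[]/eqP EP; last by move: rP; rewrite EP rL'.
  have := H L; rewrite !inE eqxx orbT => /esym/orP[]/eqP EL; last by rewrite EP EL.
  by move: rL; rewrite EL rP'.
rewrite pair_big_dep /=.
rewrite (reindex_onto (fun q => (q.2, q.1)) (fun p => (p.2, p.1))) /=.
  apply: eq_bigl => -[L P]; rewrite in_incident_pairs eqxx andbT.
  rewrite [P \in points_on M L]in_set.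
  by case: (P \in flats_rk M 1); case: (L \in flats_rk M 2).
by case.
Qed.

End Flags.

(** * The coarse flag polynomial in rank 3 *)

Section Coarse.
Variables (E : finType) (M : matroid E).
Hypothesis r3 : full_rk M = 3%N.

(** The enumeration of a set has no specified order, but a sorted permutation of
    a chain is unique. *)
Lemma sort_pair (P L : {set E}) : P \proper L ->
  sort (fun X X' : {set E} => X \subset X') (enum [set P; L]) = [:: P; L].
Proof.
move=> pPL; have PL := proper_sub pPL.
have PneL : P != L by apply: contraTneq pPL => ->; rewrite properxx.
have en : perm_eq (enum [set P; L]) [:: P; L].
  apply: uniq_perm; rewrite ?enum_uniq //= ?inE ?PneL //.
  by move=> X; rewrite mem_enum !inE.
apply: (@sorted_eq _ (fun X X' : {set E} => X \subset X')).
- by move=> Y X Z; apply: subset_trans.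
- by move=> X Y /=; rewrite -eqEsubset => /eqP.
- apply: (@sort_sorted_in _ [in [set P; L]]).
    by move=> X Y; rewrite !inE => /orP[]/eqP-> /orP[]/eqP->; rewrite ?subxx ?PL ?orbT.
  by apply/allP=> X; rewrite mem_enum.
- by rewrite /= PL.
- by rewrite perm_sort.
Qed.

Lemma flag_poincare_set0 :
  flag_poincare M set0 = pi3 #|flats_rk M 1| #|flats_rk M 2| (incidences M).
Proof.
rewrite /flag_poincare cards0 big_ord_recr big_ord0 /= mul1r.
by rewrite /flag_seq enum_set0 /= poincare_minor_full.
Qed.

Lemma flag_poincare_point P : P \in flats_rk M 1 ->
  flag_poincare M [set P] = pi1 * pi2 #|lines_through M P|.
Proof.
move=> PP; rewrite /flag_poincare cards1 !big_ord_recr big_ord0 /= mul1r.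
rewrite /flag_seq enum_set1 /= poincare_minor_point //.
by case/flats_rkP: PP => fP P1; rewrite poincare_minor_rk1 ?bot_le ?P1 ?rk_bot.
Qed.

Lemma flag_poincare_line L : L \in flats_rk M 2 ->
  flag_poincare M [set L] = pi2 #|points_on M L| * pi1.
Proof.
move=> LL; rewrite /flag_poincare cards1 !big_ord_recr big_ord0 /= mul1r.
rewrite /flag_seq enum_set1 /= poincare_minor_line //.
case/flats_rkP: LL => fL L2; rewrite poincare_minor_rk1 ?setT_flat ?subsetT //.
by rewrite L2 -r3.
Qed.

Lemma flag_poincare_pair P L : L \in flats_rk M 2 -> P \in points_on M L ->
  flag_poincare M [set P; L] = pi1 ^+ 3.
Proof.
move=> /flats_rkP[fL L2] /setIdP[/flats_rkP[fP P1] PL].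
have pPL : P \proper L by rewrite (flat_proper fP fL) PL P1 L2.
have PneL : P != L by apply: contraTneq pPL => ->; rewrite properxx.
rewrite /flag_poincare cards2 PneL !big_ord_recr big_ord0 /= mul1r.
rewrite /flag_seq sort_pair //= !poincare_minor_rk1 ?bot_le ?setT_flat ?subsetT //.
- by rewrite exprSr expr2.
- by rewrite L2 -r3.
- by rewrite L2 P1.
- by rewrite P1 rk_bot.
Qed.

(** Since [pi2] is affine in the number of atoms, only the number of summands
    and the total number of atoms matter. *)
Lemma sum_pi2 (T : finType) (A : {set T}) (d : T -> nat) :
  \sum_(x in A) pi2 (d x) =
  (1 - 'X ^+ 2) *+ #|A| + ('X + 'X ^+ 2) *+ (\sum_(x in A) d x)%N.
Proof.
rewrite -sumr_const -sumrMnr -big_split; apply: eq_bigr => x _ /=.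
by rewrite /pi2; ring.
Qed.

(** The three summands come from the empty flag, from the [a + c] flags with one
    member, whose intervals of length 2 have [2 i] atoms in total, and from the
    [i] maximal flags. *)
Definition coarse3 (a c i : nat) : {poly {poly int}} :=
  (pi3 a c i)%:P * (1 - 'X) ^+ 2
  + (pi1 * ((1 - 'X ^+ 2) *+ (a + c) + ('X + 'X ^+ 2) *+ (i + i)))%:P
    * ('X * (1 - 'X))
  + (pi1 ^+ 3 *+ i)%:P * 'X ^+ 2.

Lemma coarse_flag_poly_rk3 : coarse_flag_poly M =
  coarse3 #|flats_rk M 1| #|flats_rk M 2| (incidences M).
Proof.
rewrite /coarse_flag_poly sum_flags // r3 flag_poincare_set0 cards0 expr0 mulr1.
congr (_ + _ + _).
  under eq_bigr => P PP do
    rewrite flag_poincare_point // cards1 -mulrA expr1 expr1.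
  under [X in _ + X]eq_bigr => L LL do
    rewrite flag_poincare_line // cards1 -mulrA expr1 expr1 [_ * pi1]mulrC.
  rewrite -!mulr_suml -!rmorph_sum -!mulr_sumr -mulrDl -rmorphD -mulrDr /=.
  rewrite !sum_pi2 -incidences_sym -/(incidences M) addrACA.
  by rewrite -!mulrnDr.
rewrite /incidences -sumrMnr rmorph_sum mulr_suml; apply: eq_bigr => L LL.
rewrite -sumr_const rmorph_sum mulr_suml; apply: eq_bigr => P PL.
rewrite (flag_poincare_pair LL PL) cards2.
have -> : P != L.
  case/setIdP: PL => /flats_rkP[_ P1] _; case/flats_rkP: LL => _ L2.
  by apply: contra_eq_neq P1 => ->; rewrite L2.
by rewrite expr0 mulr1.
Qed.

End Coarse.

(** * Simple matroids *)

Definition simple (E : finType) (M : matroid E) : Prop :=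
  (forall e, M [set e] = 1%N) /\ (forall e e', e != e' -> M [set e; e'] = 2%N).

Section Simple.
Variables (E : finType) (M : matroid E).
Hypothesis sM : simple M.

Lemma simple_flats_rk1 : flats_rk M 1 = [set [set e] | e : E].
Proof.
have [sM1 sM2] := sM.
have f1 e : [set e] \in flats M.
  apply/flatP => e'; rewrite inE => e'e; rewrite sM1.
  by rewrite sM2.
apply/setP=> F; apply/flats_rkP/imsetP => [[fF F1]|[e _ ->]]; last by rewrite f1 sM1.
have [F0|[e eF]] := set_0Vmem F; first by rewrite F0 rk0 in F1.
by exists e => //; apply/esym/(flat_rk_eq (f1 e) fF); rewrite ?sub1set ?sM1 ?F1.
Qed.

Lemma simple_points_on L : #|points_on M L| = #|L|.
Proof.
rewrite -(card_imset L set1_inj); apply: eq_card => P.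
apply/setIdP/imsetP => [[]|[e eL ->]].
  by rewrite simple_flats_rk1 => /imsetP[e _ ->]; rewrite sub1set; exists e.
by rewrite sub1set simple_flats_rk1; split=> //; apply/imsetP; exists e.
Qed.

Lemma simple_coarse_flag_poly : full_rk M = 3%N -> coarse_flag_poly M =
  coarse3 #|E| #|rank2_flats M| (\sum_(L in rank2_flats M) #|L|)%N.
Proof.
move=> r3.
have -> : #|E| = #|flats_rk M 1|.
  by rewrite simple_flats_rk1 card_imset //; apply: set1_inj.
have -> : (\sum_(L in rank2_flats M) #|L|)%N = incidences M.
  by apply: eq_bigr => L _; rewrite simple_points_on.
exact: coarse_flag_poly_rk3 r3.
Qed.

(** Two distinct elements of a rank 2 flat already have rank 2, so they span it. *)
Lemma simple_rank2_flatsP F :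
  reflect (exists i j, i != j /\ F = cl M [set i; j]) (F \in rank2_flats M).
Proof.
have [sM1 sM2] := sM.
apply: (iffP (flats_rkP M 2 F)) => [[fF F2]|[i [j [ij ->]]]]; last first.
  by rewrite cl_flat rk_cl sM2.
have [F0|[i iF]] := set_0Vmem F; first by rewrite F0 rk0 in F2.
have /subsetPn[j jF ji] : ~~ (F \subset [set i]).
  by apply: contraL isT => /(rk_mono M); rewrite F2 sM1.
exists i, j; split; first by rewrite eq_sym; rewrite inE in ji.
rewrite inE in ji; apply: flat_eq_cl => //; last by rewrite F2 sM2 // eq_sym.
by rewrite subUset !sub1set iF.
Qed.

End Simple.

Definition lines_at (E : finType) (M : matroid E) (e : E) : nat :=
  #|[set L in rank2_flats M | e \in L]|.

Lemma iso_lines_at (E E' : finType) (M : matroid E) (M' : matroid E') (k : nat) :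
  matroid_iso M M' ->
  #|[set e | lines_at M e == k]| = #|[set e | lines_at M' e == k]|.
Proof.
case=> f bf Mf; have [g fK gK] := bf; have fI := bij_inj bf.
have im (S : {set E'}) : f @: (f @^-1: S) = S.
  apply/setP=> e; apply/imsetP/idP => [[x]|eS]; first by rewrite inE => xS ->.
  by exists (g e); rewrite ?inE gK.
have fl (S : {set E}) : (f @: S \in rank2_flats M') = (S \in rank2_flats M).
  apply/flats_rkP/flats_rkP; rewrite Mf => -[fS ->]; split=> //; apply/flatP.
    move=> e eS; rewrite -!Mf imsetU1; apply/(flatP M' (f @: S)) => //.
    by rewrite mem_imset.
  move=> e'; rewrite -(gK e') mem_imset // -imsetU1 !Mf.
  by apply/flatP.
have deg e : lines_at M' (f e) = lines_at M e.
  rewrite /lines_at -(card_imset _ (imset_inj fI)); apply: eq_card => L.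
  apply/setIdP/imsetP => [[]|[L0 /setIdP[LL eL] ->]]; last by rewrite fl mem_imset.
  rewrite -{1 2}(im L) fl mem_imset // => LL eL.
  by exists (f @^-1: L); rewrite ?im //; apply/setIdP.
rewrite -(card_imset _ fI); apply: eq_card => e'; rewrite -(gK e').
by rewrite mem_imset // !inE deg.
Qed.

(** * Listing the lines of a simple matroid *)

Section Listing.
Variables (n : nat) (M : matroid 'I_n) (col : nat -> nat -> nat -> bool).

(** The lines spanned by all pairs of elements, as increasing lists of numbers
    rather than sets, so that they can be computed and compared by evaluation.
    The test [col i j k] decides whether [k] is on the line spanned by [i] and
    [j]. *)
Definition list_lines : seq (seq nat) :=
  undup [seq [seq k <- iota 0 n | col p.1 p.2 k]
        | p <- [seq (i, j) | i <- iota 0 n, j <- iota 0 n] & p.1 != p.2].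

Hypothesis sM : simple M.
Hypothesis colP : forall i j : 'I_n, i != j ->
  cl M [set i; j] = [set k : 'I_n | col i j k].

Definition set_of (l : seq nat) : {set 'I_n} := [set k : 'I_n | val k \in l].

Lemma sum_rank2_flats (G : {set 'I_n} -> nat) :
  (\sum_(L in rank2_flats M) G L = \sum_(l <- list_lines) G (set_of l))%N.
Proof.
have fE i j : set_of [seq k <- iota 0 n | col i j k] = [set k : 'I_n | col i j k].
  by apply/setP=> k; rewrite !inE mem_filter mem_iota add0n ltn_ord !andbT.
rewrite -(big_map set_of xpredT) big_uniq /=.
  apply: eq_bigl => L; apply/(simple_rank2_flatsP sM)/mapP => [[i [j [ij ->]]]|].
    exists [seq k <- iota 0 n | col i j k]; last by rewrite fE colP.
    rewrite mem_undup; apply/mapP; exists (val i, val j) => //.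
    rewrite mem_filter ij /=; apply/allpairsP; exists (val i, val j).
    by rewrite /= !mem_iota !add0n !ltn_ord.
  case=> l; rewrite mem_undup => /mapP[p] /[!mem_filter] /andP[].
  move=> pn /allpairsP[[i j] /= [+ + pE]]; rewrite pE in pn; rewrite pE.
  rewrite !mem_iota /= !add0n => lti ltj -> ->.
  exists (Ordinal lti), (Ordinal ltj).
  by split=> //; rewrite colP // fE.
rewrite map_inj_in_uniq ?undup_uniq // => l l'.
rewrite !mem_undup => /mapP[p _ ->] /mapP[p' _ ->]; rewrite !fE => /setP H.
apply: eq_in_filter => k; rewrite mem_iota add0n /= => ltk.
by have := H (Ordinal ltk); rewrite !inE.
Qed.

Lemma card_rank2_flats : #|rank2_flats M| = size list_lines.
Proof. by rewrite -sum1_card sum_rank2_flats sum1_size. Qed.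

Lemma card_set_of l : l \in list_lines -> #|set_of l| = size l.
Proof.
rewrite mem_undup => /mapP[p _ ->].
rewrite cardE -(size_map val); apply: perm_size; apply: uniq_perm.
- by rewrite map_inj_uniq ?enum_uniq //; apply: val_inj.
- by rewrite filter_uniq ?iota_uniq.
move=> k; apply/mapP/idP => [[i] /[!mem_enum] /[!inE] + ->//|kl].
have ltk : (k < n)%N by move: kl; rewrite mem_filter mem_iota add0n => /and3P[].
by exists (Ordinal ltk); rewrite // mem_enum inE.
Qed.

Lemma sum_card_rank2_flats :
  (\sum_(L in rank2_flats M) #|L| = sumn (map size list_lines))%N.
Proof.
rewrite sum_rank2_flats sumnE big_map big_seq [RHS]big_seq.
by apply: eq_bigr => l /card_set_of.
Qed.

Lemma lines_atE (e : 'I_n) :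
  lines_at M e = count (fun l => val e \in l) list_lines.
Proof.
transitivity (\sum_(L in rank2_flats M) (e \in L))%N.
  rewrite /lines_at -sum1_card -big_mkcondr /=.
  by apply: eq_bigl => L; apply/setIdP/andP.
rewrite sum_rank2_flats -sum1_count [RHS]big_mkcond.
by apply: eq_bigr => l _; rewrite inE; case: ifP.
Qed.

Lemma card_lines_at k : #|[set e | lines_at M e == k]| =
  count (fun e => count (fun l => e \in l) list_lines == k) (iota 0 n).
Proof.
rewrite -val_enum_ord count_map -sum1_card -sum1_count big_enum_cond /=.
by apply: eq_bigl => e; rewrite inE /= lines_atE.
Qed.

End Listing.

(** * Arrangements and their lines of intersection *)

Section Arr.
Variables (K : fieldType) (V : vectType K) (E : finType) (A : arrangement V E).
Local Notation M := (arr_matroid A).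

(** If two planes met in codimension 1, both would equal their intersection. *)
Lemma arr_simple : simple M.
Proof.
split=> [e|e e' ee'].
  by rewrite /= /codim /inter big_set1 -(plane_dim A e) subSnn.
apply/eqP; rewrite eqn_leq; apply/andP; split.
  by apply: leq_trans (rk_card M _) _; rewrite cards2 ee'.
rewrite /= /codim interU /inter !big_set1 ltnNge; apply: contra ee' => le1.
have dE : (\dim (A e) <= \dim (A e :&: A e'))%N.
  by have := plane_dim A e; move: le1; do 3!move: (\dim _); lia.
have dE' : (\dim (A e') <= \dim (A e :&: A e'))%N.
  by have := plane_dim A e'; move: le1; do 3!move: (\dim _); lia.
apply/eqP/(@plane_inj _ _ _ A); apply: (@etrans _ _ (A e :&: A e')%VS).
  by apply/esym/eqP; rewrite eqEdim capvSl dE.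
by apply/eqP; rewrite eqEdim capvSr dE'.
Qed.

Lemma inter_cl S : inter A (cl M S) = inter A S.
Proof.
apply/eqP; rewrite eqEsubv inter_sub ?sub_cl //=.
by apply/subv_bigcapP=> e; rewrite cl_arr inE.
Qed.

Lemma flat_mem (F : {set E}) e : F \in flats M -> (inter A F <= A e)%VS = (e \in F).
Proof. by rewrite inE => /eqP {2}<-; rewrite cl_arr inE. Qed.

(** Taking intersections is a bijection from the rank 2 flats to the lines of
    intersection; a plane contains such a line exactly when it belongs to the
    flat. *)
Lemma lines_inE e : \dim {:V} = 3%N -> lines_in A e = lines_at M e.
Proof.
move=> d3; have rk2 S : (M S == 2%N) = (\dim (inter A S) == 1%N).
  by rewrite /= /codim d3; have := dim_le (inter A S); rewrite d3; lia.
have inj : {in rank2_flats M &, injective (inter A)}.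
  move=> F F' /setIdP[fF _] /setIdP[fF' _] FF'; apply/setP=> x.
  by rewrite -!flat_mem // FF'.
have pl : perm_eq (lines A) [seq inter A F | F <- enum (rank2_flats M)].
  apply: uniq_perm; rewrite ?undup_uniq //.
    rewrite map_inj_in_uniq ?enum_uniq // => F F'; rewrite !mem_enum; exact: inj.
  move=> L; rewrite mem_undup mem_filter; apply/andP/mapP.
    case=> dL /imageP[S _ LE]; exists (cl M S); last by rewrite inter_cl.
    by rewrite mem_enum; apply/setIdP; rewrite cl_flat rk2 inter_cl -LE.
  case=> F /[!mem_enum] /setIdP[fF F2] ->; split; first by rewrite -rk2.
  by apply/imageP; exists F.
rewrite /lines_in (seq.permP pl) count_map /lines_at -sum1_card -sum1_count.
rewrite big_enum_cond /=; apply: eq_bigl => F; apply/andP/setIdP => -[FF].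
  by rewrite flat_mem //; case/setIdP: FF.
by rewrite flat_mem //; case/setIdP: FF.
Qed.

End Arr.

(** * Planes with integer normal vectors *)

Definition dot (p q : int * int * int) : int :=
  p.1.1 * q.1.1 + p.1.2 * q.1.2 + p.2 * q.2.

Definition cross (p q : int * int * int) : int * int * int :=
  (p.1.2 * q.2 - p.2 * q.1.2, p.2 * q.1.1 - p.1.1 * q.2,
   p.1.1 * q.1.2 - p.1.2 * q.1.1).

Definition coplanar (N : seq (int * int * int)) (i j k : nat) : bool :=
  let n := nth (0, 0, 0) N in dot (n k) (cross (n i) (n j)) == 0.

Definition pairwise_independent (N : seq (int * int * int)) : bool :=
  pairwise (fun p q => cross p q != (0, 0, 0)) N.

Section Space.
Variables (R : realType) (n : nat) (A : arrangement 'rV[R]_3 'I_n).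
Variable N : seq (int * int * int).
Local Notation M := (arr_matroid A).

Definition ivec (v : int * int * int) : 'rV[R]_3 :=
  vec v.1.1%:~R v.1.2%:~R v.2%:~R.

Hypothesis sN : size N = n.
Hypothesis NA : forall e v, (ivec v \in A e) = (dot (nth (0, 0, 0) N e) v == 0).
Hypothesis indN : pairwise_independent N.

Lemma dim_space : \dim {:'rV[R]_3} = 3%N.
Proof. by rewrite dimvf dim_matrix. Qed.

Lemma ivec_eq0 v : ivec v = 0 -> v = (0, 0, 0).
Proof.
case: v => [[a b] c] /rowP v0.
have := v0 0; have := v0 1; have := v0 2%:R; rewrite !mxE /=.
by move=> /eqP + /eqP + /eqP; rewrite !intr_eq0 => /eqP-> /eqP-> /eqP->.
Qed.

Lemma cross_neq0 (i j : 'I_n) : i != j ->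
  cross (nth (0, 0, 0) N i) (nth (0, 0, 0) N j) != (0, 0, 0).
Proof.
have lt (i' j' : 'I_n) : (i' < j')%N ->
  cross (nth (0, 0, 0) N i') (nth (0, 0, 0) N j') != (0, 0, 0).
  move=> ij; move/(pairwiseP (0, 0, 0)): indN.
  by apply=> //; rewrite inE sN.
case: (ltngtP i j) => [ij _|ij _|/val_inj->]; last by rewrite eqxx.
  exact: lt.
(* The cross product is antisymmetric. *)
have := lt _ _ ij; apply: contra_neq; rewrite /cross => -[a b c].
by congr (_, _, _); apply: oppr_inj; rewrite oppr0;
  [rewrite -[RHS]a | rewrite -[RHS]b | rewrite -[RHS]c]; ring.
Qed.

(** The cross product [u] of the normals spans the intersection of the two
    planes, and the [k]-th plane contains [u] when its normal is orthogonal
    to [u]. *)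
Lemma coplanarP (i j : 'I_n) : i != j ->
  cl M [set i; j] = [set k : 'I_n | coplanar N i j k].
Proof.
move=> ij; set u := ivec (cross (nth (0, 0, 0) N i) (nth (0, 0, 0) N j)).
have u0 : u != 0 by apply: contra_neq (cross_neq0 ij); apply: ivec_eq0.
have interE : inter A [set i; j] = <[u]>%VS.
  apply/esym/eqP; rewrite eqEdim -memvE interU memv_cap /inter !big_set1 !NA.
  have -> : dot (nth (0, 0, 0) N i)
      (cross (nth (0, 0, 0) N i) (nth (0, 0, 0) N j)) == 0.
    by rewrite /dot /cross /=; apply/eqP; ring.
  have -> /= : dot (nth (0, 0, 0) N j)
      (cross (nth (0, 0, 0) N i) (nth (0, 0, 0) N j)) == 0.
    by rewrite /dot /cross /=; apply/eqP; ring.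
  rewrite dim_vline u0; have [_ /(_ _ _ ij)] := arr_simple A.
  by rewrite /= /codim dim_space interU /inter !big_set1; lia.
by rewrite cl_arr interE; apply/setP=> k; rewrite !inE -memvE NA.
Qed.

Lemma full_rk_space (i j k : 'I_n) : i != j -> ~~ coplanar N i j k ->
  full_rk M = 3%N.
Proof.
move=> ij nc; apply/eqP; rewrite eqn_leq; apply/andP; split.
  by rewrite /full_rk /= /codim dim_space leq_subr.
have [_ /(_ _ _ ij) r2] := arr_simple A.
have : k \notin cl M [set i; j] by rewrite coplanarP // inE.
rewrite inE => kcl.
have lt2 : (M [set i; j] < M (k |: [set i; j]))%N.
  by rewrite ltn_neqAle eq_sym kcl rk_mono // subsetU1.
by rewrite r2 in lt2; apply: leq_trans lt2 (rk_le_full M _).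
Qed.

End Space.

(** * The two arrangements *)

Definition normalsA : seq (int * int * int) :=
  [:: (1, 0, 0); (0, 1, 0); (0, 0, 1); (1, 1, 0); (1, -1, 0); (1, 2, 0);
      (1, 0, 1); (0, 1, 1); (1, 1, 1)].

Definition normalsB : seq (int * int * int) :=
  [:: (1, 0, 0); (0, 1, 0); (0, 0, 1); (1, 1, 0); (1, 2, 0); (1, -2, 0);
      (1, 0, 1); (0, 2, 1); (2, 2, 1)].

Lemma mem_planeA (R : realType) (e : 'I_9) (v : int * int * int) :
  (ivec R v \in arrA R e) = (dot (nth (0, 0, 0) normalsA e) v == 0).
Proof.
rewrite memv_ker formsA_vec -(intr_eq0 R); case: v => [[a b] c]; rewrite /dot.
congr (_ == 0); case: e => -[|[|[|[|[|[|[|[|[|//]]]]]]]]] lt9 /=;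
  rewrite !rmorphE /=; ring.
Qed.

Lemma mem_planeB (R : realType) (e : 'I_9) (v : int * int * int) :
  (ivec R v \in arrB R e) = (dot (nth (0, 0, 0) normalsB e) v == 0).
Proof.
rewrite memv_ker formsB_vec -(intr_eq0 R); case: v => [[a b] c]; rewrite /dot.
congr (_ == 0); case: e => -[|[|[|[|[|[|[|[|[|//]]]]]]]]] lt9 /=;
  rewrite !rmorphE /=; ring.
Qed.

(** A triple [i], [j], [k] of independent normals forces rank 3; the other
    numbers are counts over the computed list of rank 2 flats. *)
Lemma arr_counts (R : realType) (n : nat) (A : arrangement 'rV[R]_3 'I_n)
    (N : seq (int * int * int)) (i j k : 'I_n) :
  let ls := list_lines n (coplanar N) in
  size N = n ->
  (forall e v, (ivec R v \in A e) = (dot (nth (0, 0, 0) N e) v == 0)) ->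
  pairwise_independent N -> i != j -> ~~ coplanar N i j k ->
  [/\ full_rk (arr_matroid A) = 3%N,
      #|rank2_flats (arr_matroid A)| = size ls,
      (\sum_(F in rank2_flats (arr_matroid A)) #|F| = sumn (map size ls))%N
    & forall d : nat, #|[set e | lines_at (arr_matroid A) e == d]| =
        count (fun e => count (fun l => e \in l) ls == d) (iota 0 n)].
Proof.
move=> ls sN NA indN ij nc.
have colP := coplanarP sN NA indN; have sM := arr_simple A.
split; [exact: full_rk_space ij nc | exact: card_rank2_flats |
  exact: sum_card_rank2_flats | move=> d; exact: card_lines_at].
Qed.

Theorem mainTheorem6 (R : realType) :
  let A := arrA R in
  let B := arrB R in
  let MA := arr_matroid A in
  let MB := arr_matroid B in
  [/\ [/\ full_rk MA = 3%N, #|rank2_flats MA| = 15%N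
        & (\sum_(F in rank2_flats MA) #|F| = 39)%N],
      [/\ full_rk MB = 3%N, #|rank2_flats MB| = 15%N
        & (\sum_(F in rank2_flats MB) #|F| = 39)%N],
      #|[set e : 'I_9 | lines_in A e == 3%N]| = 2%N
        /\ #|[set e : 'I_9 | lines_in B e == 3%N]| = 1%N,
      coarse_flag_poly MA = coarse_flag_poly MB
    & ~ matroid_iso MA MB].
Proof.
move=> A B MA MB.
(* The planes 0, 1, 2 are the coordinate planes, which have no common line. *)
have [] := @arr_counts R 9 A normalsA 0 1 2%:R erefl (@mem_planeA R) isT isT isT.
rewrite -/MA => rA cA tA /(_ 3%N) dA.
have [] := @arr_counts R 9 B normalsB 0 1 2%:R erefl (@mem_planeB R) isT isT isT.
rewrite -/MB => rB cB tB /(_ 3%N) dB.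
have {}cA : #|rank2_flats MA| = 15%N by rewrite cA; vm_compute.
have {}cB : #|rank2_flats MB| = 15%N by rewrite cB; vm_compute.
have {}tA : (\sum_(F in rank2_flats MA) #|F| = 39)%N by rewrite tA; vm_compute.
have {}tB : (\sum_(F in rank2_flats MB) #|F| = 39)%N by rewrite tB; vm_compute.
have {}dA : #|[set e | lines_at MA e == 3%N]| = 2%N by rewrite dA; vm_compute.
have {}dB : #|[set e | lines_at MB e == 3%N]| = 1%N by rewrite dB; vm_compute.
split=> //.
- split; [rewrite -[RHS]dA | rewrite -[RHS]dB]; apply: eq_card => e;
    by rewrite !inE lines_inE // dim_space.
- rewrite (simple_coarse_flag_poly (arr_simple A) rA).
  rewrite (simple_coarse_flag_poly (arr_simple B) rB).
  by rewrite -/MA -/MB cA cB tA tB.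
- by move=> /(iso_lines_at 3); rewrite dA dB.
Qed.
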